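(* Consider an instance of the Capacitated $p$-Location Problem with Territorial Coverage Constraints given by $\langle J,I,p,W,R\rangle$ and a partition $S=\{S_1,\ldots,S_{m^S}\}$ of $I$, with $p\le m^S$, so that the coverage constraints are $\sum_{j\in J(S_k)}y_j\le 1$ for all $k\in\{1,\ldots,m^S\}$. Let $J'\subseteq J$ be such that $|J'|=p$ and $$\sum_{j\in J'}R_j<\sum_{i\in I}W_i,$$ and such that the elements of $J'$ belong to pairwise distinct subareas; for $j\in J'$ denote by $S_{k(j)}$ the subarea with $j\in J(S_{k(j)})$. For each $j\in J'$ let $\bar J_{k(j)}\subseteq J(S_{k(j)})$ be a set of locations such that $R_j\ge R_{j'}$ for every $j'\in\bar J_{k(j)}$. Then every feasible solution $(x,y)$ satisfies $$\sum_{j\in J'}\ \sum_{j'\in\bar J_{k(j)}}y_{j'}\le p-1 .$$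
   Context: An instance $\langle J,I,p,W,R\rangle$ of the Capacitated $p$-Location Problem (CpLP) consists of a finite set $I$ of customers, a finite set $J$ of candidate facility locations, an integer $p$, demands $W_i\ge 0$ ($i\in I$), capacities $R_j\ge 0$ ($j\in J$), together with allocation costs $cost(i,j)$. Feasible solutions are pairs $(x,y)$ with $y_j\in\{0,1\}$ and $$\sum_{j\in J}x_{ij}=1\ (i\in I),\qquad \sum_{j\in J}y_j=p,\qquad \sum_{i\in I}W_ix_{ij}\le R_jy_j\ (j\in J),$$ where either $x_{ij}\in\{0,1\}$ (capacitated $p$-median variant) or $x_{ij}\in[0,1]$ (relaxed variant); the CpLP covers both variants, and the objective is to minimize $\sum_{i,j}cost(i,j)x_{ij}$. The customers in $I$ are distinct spatial units making up a geographical area, and each location in $J$ is a point lying in exactly one of these units. For a block (subarea) $S_k$ of a partition $S=\{S_1,\ldots,S_{m^S}\}$ of $I$, $J(S_k)\subseteq J$ is the set of locations lying within $S_k$. The problem with Territorial Coverage Constraints (CpLP-TC) adds to the CpLP the constraints $\sum_{j\in J(S_k)}y_j\ge 1$ for all $k$ if $p\ge m^S$, and $\sum_{j\in J(S_k)}y_j\le 1$ for all $k$ if $p\le m^S$. *)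

(* Defs.v *)
From HB Require Import structures.
From mathcomp Require Import all_boot all_order all_algebra.

Set Implicit Arguments.
Unset Strict Implicit.
Unset Printing Implicit Defensive.

Import Order.TTheory GRing.Theory Num.Theory.
Local Open Scope ring_scope.

Record CpLP (K : realFieldType) (I J : finType) := MkCpLP {
  nfac : nat;              (* p *)
  demand : I -> K;         (* W *)
  capacity : J -> K;       (* R *)
  cost : I -> J -> K;
  unit_of : J -> I;        (* the one spatial unit in which a location lies *)
  demand_ge0 : forall i, 0 <= demand i;
  capacity_ge0 : forall j, 0 <= capacity j
}.

(* Median: allocations x_ij in {0,1}; Relaxed: x_ij in [0,1]. *)
Inductive variant := Median | Relaxed.

Section CpLPDefs.

Variables (K : realFieldType) (I J : finType) (P : CpLP K I J).

Definition allocation_domain (v : variant) (t : K) : Prop :=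
  match v with
  | Median => t = 0 \/ t = 1
  | Relaxed => 0 <= t <= 1
  end.

Definition CpLP_feasible (v : variant) (x : I -> J -> K) (y : J -> K) : Prop :=
  [/\ forall i j, allocation_domain v (x i j),
      forall j, y j = 0 \/ y j = 1,
      forall i, \sum_(j : J) x i j = 1,
      \sum_(j : J) y j = (nfac P)%:R
    & forall j, \sum_(i : I) demand P i * x i j <= capacity P j * y j].

(* J(B), for a subarea B *)
Definition locations_in (B : {set I}) : {set J} := [set j | unit_of P j \in B].

(* S_{k(j)}: when S partitions [set: I], this is the only B in S such that
   j \in locations_in B. *)
Definition subarea_of (S : {set {set I}}) (j : J) : {set I} :=
  pblock S (unit_of P j).

(* When p = #|S| both families of constraints are imposed. *)
Definition territorial_coverage (S : {set {set I}}) (y : J -> K) : Prop :=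
  ((#|S| <= nfac P)%N ->
     forall B, B \in S -> 1 <= \sum_(j in locations_in B) y j) /\
  ((nfac P <= #|S|)%N ->
     forall B, B \in S -> \sum_(j in locations_in B) y j <= 1).

Definition CpLP_TC_feasible (v : variant) (S : {set {set I}})
    (x : I -> J -> K) (y : J -> K) : Prop :=
  CpLP_feasible v x y /\ territorial_coverage S y.

End CpLPDefs.

(* Main.v *)
(** If the sum exceeded [p - 1], integrality would make it at least [p]. The sets
    $\bar J_{k(j)}$ lie in distinct blocks, hence are disjoint, so all [p] open
    facilities lie in their union, at most one in each. Replacing each of them by
    the corresponding [j] in [J'] cannot decrease the capacity, so [J'] would
    cover the total demand. *)

Require Import Defs.
From HB Require Import structures.
From mathcomp Require Import all_boot all_order all_algebra.

Set Implicit Arguments.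
Unset Strict Implicit.
Unset Printing Implicit Defensive.

Import Order.TTheory GRing.Theory Num.Theory.
Local Open Scope ring_scope.

Section Feasible.

Variables (K : realFieldType) (I J : finType) (P : CpLP K I J) (v : variant).
Variables (x : I -> J -> K) (y : J -> K).
Hypothesis xy_feasible : CpLP_feasible P v x y.

Lemma feasible_natE j : y j = (y j != 0)%:R.
Proof.
case: xy_feasible => _ y01 _ _ _.
by case: (y01 j) => ->; rewrite ?eqxx ?oner_eq0.
Qed.

Lemma feasible_ge0 j : 0 <= y j.
Proof. by rewrite feasible_natE ler0n. Qed.

(** Summing the capacity constraints over all locations suffices: after exchanging the sums, each
    customer's allocations add up to 1. *)
Lemma demand_le_open_capacity :
  \sum_(i : I) demand P i <= \sum_(j : J) capacity P j * y j.
Proof.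
case: xy_feasible => _ _ x1 _ cap.
have -> : \sum_i demand P i = \sum_j \sum_i demand P i * x i j.
  rewrite exchange_big; apply: eq_bigr => i _ /=.
  by rewrite -mulr_sumr x1 mulr1.
exact: ler_sum.
Qed.

End Feasible.

(** Double counting: [f b] occurs once for each [a] in [D] whose set [F a] contains [b]. *)
Lemma sum_sum_mem (R : pzSemiRingType) (A B : finType) (D : {set A})
    (F : A -> {set B}) (f : B -> R) :
  \sum_(a in D) \sum_(b in F a) f b =
  \sum_b #|[set a in D | b \in F a]|%:R * f b.
Proof.
rewrite (exchange_big_dep predT) //=; apply: eq_bigr => b _.
rewrite sumr_const mulr_natl; congr (_ *+ _).
by apply: eq_card => a; rewrite !inE.
Qed.

(** A location lies in a single block, and by injectivity at most one element of [D] has that block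
    as its subarea. *)
Lemma card_subarea_le1 (K : realFieldType) (I J : finType) (P : CpLP K I J)
    (S : {set {set I}}) (D : {set J}) (F : {set I} -> {set J}) (b : J) :
  trivIset S -> cover S = [set: I] ->
  {in D &, injective (subarea_of P S)} ->
  (forall j, j \in D ->
     F (subarea_of P S j) \subset locations_in P (subarea_of P S j)) ->
  (#|[set j in D | b \in F (subarea_of P S j)]| <= 1)%N.
Proof.
move=> trivS covS injD subF.
have block j : j \in D -> b \in F (subarea_of P S j) ->
    subarea_of P S j = subarea_of P S b.
  move=> Dj /(subsetP (subF j Dj)); rewrite inE => bj; apply/esym.
  by apply: def_pblock bj => //; rewrite pblock_mem ?covS ?inE.
apply/card_le1_eqP => j1 j2; rewrite !inE => /andP[D1 b1] /andP[D2 b2].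
by apply: injD; rewrite // (block _ D1 b1) (block _ D2 b2).
Qed.

Theorem mainTheorem4 (K : realFieldType) (I J : finType) (P : CpLP K I J)
    (v : variant) (S : {set {set I}})
    (S_partition : partition S [set: I])
    (p_le_mS : (nfac P <= #|S|)%N)
    (J' : {set J})
    (card_J' : #|J'| = nfac P)
    (J'_capacity : \sum_(j in J') capacity P j < \sum_(i : I) demand P i)
    (J'_distinct : {in J' &, injective (subarea_of P S)})
    (Jbar : {set I} -> {set J})
    (Jbar_sub : forall j, j \in J' ->
       Jbar (subarea_of P S j) \subset locations_in P (subarea_of P S j))
    (Jbar_capacity : forall j, j \in J' ->
       forall j', j' \in Jbar (subarea_of P S j) ->
         capacity P j' <= capacity P j)
    (x : I -> J -> K) (y : J -> K)
    (xy_feasible : CpLP_TC_feasible P v S x y) :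
  \sum_(j in J') \sum_(j' in Jbar (subarea_of P S j)) y j' <= (nfac P)%:R - 1.
Proof.
case: xy_feasible => feas [_ /(_ p_le_mS) cover_le1].
have y_ge0 := feasible_ge0 feas.
case/and3P: S_partition => /eqP covS trivS _.
pose F j := Jbar (subarea_of P S j).
have [// | lt_sum] := lerP.
have p_le : (nfac P)%:R <= \sum_(j in J') \sum_(j' in F j) y j'.
  have natE : \sum_(j in J') \sum_(j' in F j) y j' =
      (\sum_(j in J') \sum_(j' in F j) (y j' != 0%R))%:R.
    rewrite natr_sum; apply: eq_bigr => j _; rewrite natr_sum.
    by apply: eq_bigr => j' _; exact: feasible_natE feas j'.
  by move: lt_sum; rewrite natE ltrBlDr natr1 ltr_nat ltnS ler_nat.
pose c j' := #|[set j in J' | j' \in F j]|.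
have c_le1 j' : (c j' <= 1)%N by exact: card_subarea_le1.
(* Each gap [y k - c k * y k] is nonnegative since [c k <= 1], while the gaps add up to [p] minus
   the double sum, which is at most 0. Hence all gaps vanish: every open location lies in exactly
   one [F j]. *)
have c_y j' : (c j')%:R * y j' = y j'.
  have gap_ge0 k : true -> 0 <= y k - (c k)%:R * y k.
    by move=> _; rewrite subr_ge0 ler_piMl // -[1]/(1%:R) ler_nat.
  have gap0 : \sum_k (y k - (c k)%:R * y k) == 0.
    rewrite eq_le sumr_ge0 // andbT sumrB -sum_sum_mem subr_le0.
    by case: feas => _ _ _ -> _.
  move: gap0; rewrite psumr_eq0 // => /allP/(_ j' (mem_index_enum _)).
  by rewrite subr_eq0 => /eqP <-.
have : \sum_i demand P i <= \sum_(j in J') capacity P j.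
  apply: le_trans (demand_le_open_capacity feas) _.
  (* Inserting the multiplicities [c] regroups the open capacity according to the sets [F j]. *)
  under eq_bigr => j _ do rewrite -c_y mulrCA.
  rewrite -(sum_sum_mem J' F (fun j => capacity P j * y j)).
  apply: ler_sum => j J'j.
  apply: (@le_trans _ _ (\sum_(j' in F j) capacity P j * y j')).
    by apply: ler_sum => j' Fj'; rewrite ler_wpM2r // Jbar_capacity.
  rewrite -mulr_sumr ler_piMr ?capacity_ge0 //.
  have SB : subarea_of P S j \in S by rewrite pblock_mem ?covS ?inE.
  apply: le_trans (cover_le1 _ SB).
  (* The coverage bound for the whole block passes to [F j], as the locations outside [F j]
     contribute nonnegative terms. *)
  rewrite [leRHS](big_setID (F j)) /= (setIidPr (Jbar_sub _ J'j)) lerDl.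
  exact: sumr_ge0.
by rewrite leNgt J'_capacity.
Qed.
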